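(* ($\mathcal P$-excluded Lock-freedom) If $\vdash_{\mathcal P}\mathbb M:\mathsf G$, then $\mathbb M$ is $\mathcal P$-excluded lock-free, i.e. whenever $\mathbb M\xrightarrow{\sigma}\mathbb M'$ for a finite trace $\sigma$ and $\mathsf p\in\mathrm{prt}(\mathbb M')\setminus\mathcal P$, there are a finite trace $\sigma'$ and a label $\Lambda$ with $\mathsf p\in\mathrm{prt}(\Lambda)$ and a session $\mathbb M''$ such that $\mathbb M'\xrightarrow{\sigma'\cdot\Lambda}\mathbb M''$.
   Context: Messages $\lambda$ and participants $\mathsf p,\mathsf q,\dots$ are drawn from given sets. Processes are the possibly infinite but regular (finitely many distinct subterms) terms coinductively generated by $P::=\mathbf 0\mid \mathsf p!\{\lambda_i.P_i\}_{i\in I}\mid \mathsf p?\{\lambda_i.P_i\}_{i\in I}$, with $I$ finite nonempty and the $\lambda_i$ pairwise distinct ($\mathsf p!$ is output to $\mathsf p$, $\mathsf p?$ is input from $\mathsf p$). A multiparty session is $\mathsf p_1[\![P_1]\!]\parallel\cdots\parallel\mathsf p_n[\![P_n]\!]$ with pairwise distinct $\mathsf p_j$; sessions are taken modulo structural congruence (parallel composition associative, commutative, with $\mathsf p[\![\mathbf 0]\!]$ neutral). $\mathsf p[\![P]\!]\in\mathbb M$ means $P\neq\mathbf 0$ and $\mathbb M\equiv \mathsf p[\![P]\!]\parallel\mathbb M'$; $\mathrm{prt}(\mathbb M)=\{\mathsf p\mid \mathsf p[\![P]\!]\in\mathbb M\}$. Session transitions are the closure under structural congruence of: $\mathsf p[\![\mathsf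 q!\{\lambda_i.P_i\}_{i\in I}]\!]\parallel\mathsf q[\![\mathsf p?\{\lambda_j.Q_j\}_{j\in J}]\!]\parallel\mathbb M\xrightarrow{\mathsf p\lambda_h\mathsf q}\mathsf p[\![P_h]\!]\parallel\mathsf q[\![Q_h]\!]\parallel\mathbb M$ whenever $h\in I\subseteq J$. Labels $\Lambda$ are triples $\mathsf p\lambda\mathsf q$ with $\mathrm{prt}(\mathsf p\lambda\mathsf q)=\{\mathsf p,\mathsf q\}$; for a finite trace $\sigma=\Lambda_1\cdots\Lambda_n$ ($n\ge0$), $\mathbb M\xrightarrow{\sigma}\mathbb M'$ means $\mathbb M\xrightarrow{\Lambda_1}\mathbb M_1\cdots\xrightarrow{\Lambda_n}\mathbb M_n=\mathbb M'$. Global types are regular terms coinductively generated by $\mathsf G::=\mathsf{End}\mid \mathsf p\to\mathsf q:\{\lambda_i.\mathsf G_i\}_{i\in I}$ ($I$ finite nonempty, $\lambda_i$ pairwise distinct). Traces are finite or infinite sequences of labels; $\mathrm{paths}(\mathsf G)$ is the greatest set of traces with $\mathrm{paths}(\mathsf{End})=\{\epsilon\}$ and $\mathrm{paths}(\mathsf p\to\mathsf q:\{\lambda_i.\mathsf G_i\}_{i\in I})=\bigcup_{i\in I}\{\mathsf p\lambda_i\mathsf q\cdot\sigma\mid \sigma\in\mathrm{paths}(\mathsf G_i)\}$. $\mathrm{prt}(\sigma)$ is the union over its labels, and $\mathrm{prt}(\mathsf G)=\bigcup_{\sigma\in\mathrm{paths}(\mathsf G)}\mathrm{prt}(\sigma)$.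 For $\sigma\in\mathrm{paths}(\mathsf G)$, $\mathrm{depth}(\sigma,\mathsf p)=\inf\{n\mid \mathsf p\in\mathrm{prt}(\sigma[n])\}$ ($\inf\emptyset=\infty$); $\mathrm{depth}(\mathsf G,\mathsf p)=\sup\{\mathrm{depth}(\sigma,\mathsf p)\mid\sigma\in\mathrm{paths}(\mathsf G)\}$ if $\mathsf p\in\mathrm{prt}(\mathsf G)$ and $0$ otherwise. $\mathsf G$ is bounded if $\mathrm{depth}(\mathsf G',\mathsf p)$ is finite for every global type $\mathsf G'$ occurring in $\mathsf G$ (as a subterm, including $\mathsf G$ itself) and every $\mathsf p\in\mathrm{prt}(\mathsf G')$. The typing relation $\vdash_{\mathcal P}\mathbb M:\mathsf G$ ($\mathcal P$ a finite set of participants, the ''ignored'' ones) is the largest relation (rules interpreted coinductively, sessions modulo structural congruence) closed under: (End) $\vdash_{\emptyset}\mathsf p[\![\mathbf 0]\!]:\mathsf{End}$; (Comm) if for all $i\in I$: $\vdash_{\mathcal P_i}\mathsf p[\![P_i]\!]\parallel\mathsf q[\![Q_i]\!]\parallel\mathbb M:\mathsf G_i$ and $(\mathrm{prt}(\mathsf G_i)\cup\mathcal P_i)\setminus\{\mathsf p,\mathsf q\}=\mathrm{prt}(\mathbb M)$, and $I\subseteq J$ and $\mathsf G=\mathsf p\to\mathsf q:\{\lambda_i.\mathsf G_i\}_{i\in I}$ is bounded, then $\vdash_{\bigcup_{i\in I}\mathcal P_i}\mathsf p[\![\mathsf q!\{\lambda_i.P_i\}_{i\in I}]\!]\parallel\mathsf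 q[\![\mathsf p?\{\lambda_j.Q_j\}_{j\in J}]\!]\parallel\mathbb M:\mathsf G$; (Weak) if $\vdash_{\mathcal P_1}\mathbb M_1:\mathsf G$ and $\mathcal P_2=\mathrm{prt}(\mathbb M_2)\neq\emptyset$, then $\vdash_{\mathcal P_1\cup\mathcal P_2}\mathbb M_1\parallel\mathbb M_2:\mathsf G$. *)

(* Defs.v *)
From Stdlib Require List.
From mathcomp Require Import all_boot.
From mathcomp Require Import boolp classical_sets cardinality.

Set Implicit Arguments.
Unset Strict Implicit.
Unset Printing Implicit Defensive.

Local Open Scope classical_set_scope.

(* Since the messages of a branching {lambda_i.X_i}_{i in I} are pairwise
   distinct, the branching is a partial map from messages, and I is identified
   with its domain. *)
Definition branching (Msg X : Type) := Msg -> option X.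

Definition bdom (Msg X : Type) (b : branching Msg X) : set Msg :=
  [set m | exists x, b m = Some x].

Definition proper_branching (Msg X : Type) (b : branching Msg X) : Prop :=
  finite_set (bdom b) /\ bdom b !=set0.

CoInductive proc (Part Msg : Type) : Type :=
| Zero
| Out (q : Part) (b : branching Msg (proc Part Msg))
| Inp (q : Part) (b : branching Msg (proc Part Msg)).

Arguments Zero {Part Msg}.

Inductive subproc (Part Msg : Type) (Q : proc Part Msg) :
    proc Part Msg -> Prop :=
| subproc_refl : subproc Q Q
| subproc_out q b m P : b m = Some P -> subproc Q P -> subproc Q (Out q b)
| subproc_inp q b m P : b m = Some P -> subproc Q P -> subproc Q (Inp q b).

(* Equality of possibly infinite terms is bisimilarity, which is coarser than
   Leibniz equality on a coinductive type.  It is needed only to count distinct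
   subterms: transitions, paths and typing inspect terms one constructor at a
   time, so typability and, up to bisimilarity, transitions are unchanged when
   terms are replaced by bisimilar ones. *)
CoInductive bisim_proc (Part Msg : Type) :
    proc Part Msg -> proc Part Msg -> Prop :=
| bisim_zero : bisim_proc Zero Zero
| bisim_out q b c : bdom b = bdom c ->
    (forall m P Q, b m = Some P -> c m = Some Q -> bisim_proc P Q) ->
    bisim_proc (Out q b) (Out q c)
| bisim_inp q b c : bdom b = bdom c ->
    (forall m P Q, b m = Some P -> c m = Some Q -> bisim_proc P Q) ->
    bisim_proc (Inp q b) (Inp q c).

Definition regular_proc (Part Msg : Type) (P : proc Part Msg) : Prop :=
  exists s : seq (proc Part Msg),
    forall Q, subproc Q P -> exists2 R, List.In R s & bisim_proc Q R.

(* [proc] also contains non-regular terms and terms with empty or infinite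
   branchings; the processes are the terms satisfying [wf_proc].  Likewise for
   [gtype] and [wf_gtype] below. *)
Definition wf_proc (Part Msg : Type) (P : proc Part Msg) : Prop :=
  regular_proc P /\
  forall Q, subproc Q P ->
    match Q with
    | Zero => True
    | Out _ b | Inp _ b => proper_branching b
    end.

(* Parallel composition is concatenation, which is associative.  The empty
   composition [::] is congruent to p[[0]]; having it as a term makes
   decompositions such as M = p[[P]] || M' available even when there is no
   participant left to name in a null component M'. *)
Definition session (Part Msg : Type) := seq (Part * proc Part Msg).

Definition wf_session (Part Msg : Type) (M : session Part Msg) : Prop :=
  List.NoDup [seq x.1 | x <- M] /\
  forall p P, List.In (p, P) M -> wf_proc P.

Inductive congr_raw (Part Msg : Type) :
    session Part Msg -> session Part Msg -> Prop :=
| congr_refl M : congr_raw M M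
| congr_sym M N : congr_raw M N -> congr_raw N M
| congr_trans M N K : congr_raw M N -> congr_raw N K -> congr_raw M K
| congr_par M M' N N' :
    congr_raw M M' -> congr_raw N N' -> congr_raw (M ++ N) (M' ++ N')
| congr_comm M N : congr_raw (M ++ N) (N ++ M)
| congr_zero p M : congr_raw ([:: (p, Zero)] ++ M) M.

Definition scongr (Part Msg : Type) (M N : session Part Msg) : Prop :=
  [/\ wf_session M, wf_session N & congr_raw M N].

Definition in_session (Part Msg : Type) (p : Part) (P : proc Part Msg)
    (M : session Part Msg) : Prop :=
  P <> Zero /\ exists M', scongr M ([:: (p, P)] ++ M').

Definition sprt (Part Msg : Type) (M : session Part Msg) : set Part :=
  [set p | exists P, in_session p P M].

Record label (Part Msg : Type) :=
  Label { sender : Part; message : Msg; receiver : Part }.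

Definition lprt (Part Msg : Type) (L : label Part Msg) : set Part :=
  [set sender L; receiver L].

Inductive step (Part Msg : Type) :
    session Part Msg -> label Part Msg -> session Part Msg -> Prop :=
| step_comm p q b c M m P Q :
    wf_session ([:: (p, Out q b)] ++ [:: (q, Inp p c)] ++ M) ->
    bdom b `<=` bdom c ->
    b m = Some P -> c m = Some Q ->
    step ([:: (p, Out q b)] ++ [:: (q, Inp p c)] ++ M)
         (Label p m q)
         ([:: (p, P)] ++ [:: (q, Q)] ++ M)
| step_congr M N L N' M' :
    scongr M N -> step N L N' -> scongr N' M' -> step M L M'.

Inductive steps (Part Msg : Type) :
    session Part Msg -> seq (label Part Msg) -> session Part Msg -> Prop :=
| steps_nil M M' : scongr M M' -> steps M [::] M'
| steps_cons M L N s M' : step M L N -> steps N s M' -> steps M (L :: s) M'.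

CoInductive gtype (Part Msg : Type) : Type :=
| End
| Comm (p q : Part) (b : branching Msg (gtype Part Msg)).

Arguments End {Part Msg}.

Inductive subgtype (Part Msg : Type) (H : gtype Part Msg) :
    gtype Part Msg -> Prop :=
| subgtype_refl : subgtype H H
| subgtype_comm p q b m G :
    b m = Some G -> subgtype H G -> subgtype H (Comm p q b).

CoInductive bisim_gtype (Part Msg : Type) :
    gtype Part Msg -> gtype Part Msg -> Prop :=
| bisim_end : bisim_gtype End End
| bisim_comm p q b c : bdom b = bdom c ->
    (forall m G H, b m = Some G -> c m = Some H -> bisim_gtype G H) ->
    bisim_gtype (Comm p q b) (Comm p q c).

Definition regular_gtype (Part Msg : Type) (G : gtype Part Msg) : Prop :=
  exists s : seq (gtype Part Msg),
    forall H, subgtype H G -> exists2 K, List.In K s & bisim_gtype H K.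

Definition wf_gtype (Part Msg : Type) (G : gtype Part Msg) : Prop :=
  regular_gtype G /\
  forall H, subgtype H G ->
    match H with
    | End => True
    | Comm _ _ b => proper_branching b
    end.

CoInductive trace (Part Msg : Type) : Type :=
| Tnil
| Tcons (L : label Part Msg) (s : trace Part Msg).

Arguments Tnil {Part Msg}.

(* Positions are counted from 0.  Counting from 1, or reading s[n] as the
   prefix of length n, adds 1 to every finite depth of a trace, which is
   immaterial for boundedness. *)
Fixpoint tnth (Part Msg : Type) (s : trace Part Msg) (n : nat) :
    option (label Part Msg) :=
  match s, n with
  | Tnil, _ => None
  | Tcons L _, 0 => Some L
  | Tcons _ s', n'.+1 => tnth s' n'
  end.

CoInductive paths (Part Msg : Type) :
    gtype Part Msg -> trace Part Msg -> Prop :=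
| paths_end : paths End Tnil
| paths_comm p q b m G s :
    b m = Some G -> paths G s -> paths (Comm p q b) (Tcons (Label p m q) s).

Definition tprt (Part Msg : Type) (s : trace Part Msg) : set Part :=
  [set p | exists n L, tnth s n = Some L /\ lprt L p].

Definition gprt (Part Msg : Type) (G : gtype Part Msg) : set Part :=
  \bigcup_(s in paths G) tprt s.

(* Natural numbers extended with infinity, which is [None]. *)
Definition enat := option nat.

Definition enat_inf (A : set nat) : enat :=
  if pselect (exists n, `[< A n >]) is left ex then Some (ex_minn ex) else None.

Definition enat_sup (D : set enat) : enat :=
  enat_inf [set n | forall d, D d -> exists2 k, d = Some k & (k <= n)%N].

Definition tdepth (Part Msg : Type) (s : trace Part Msg) (p : Part) : enat :=
  enat_inf [set n | exists2 L, tnth s n = Some L & lprt L p].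

Definition gdepth (Part Msg : Type) (G : gtype Part Msg) (p : Part) : enat :=
  if `[< gprt G p >] then enat_sup [set tdepth s p | s in paths G]
  else Some 0.

Definition bounded (Part Msg : Type) (G : gtype Part Msg) : Prop :=
  forall H p, subgtype H G -> gprt H p -> gdepth H p <> None.

(* Structural congruence is built into each rule rather than being a rule of
   its own, which could be iterated forever in a coinductive derivation.
   Finiteness of the set of ignored participants need not be imposed: each rule
   bounds that set by the participants of the session. *)
CoInductive typing (Part Msg : Type) :
    set Part -> session Part Msg -> gtype Part Msg -> Prop :=
| typing_end M p : scongr M [:: (p, Zero)] -> typing set0 M End
| typing_comm M p q (b c : branching Msg (proc Part Msg)) N
    (g : branching Msg (gtype Part Msg)) (Ps : Msg -> set Part) :
    scongr M ([:: (p, Out q b)] ++ [:: (q, Inp p c)] ++ N) ->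
    bdom g = bdom b ->
    (forall m P Q G, b m = Some P -> c m = Some Q -> g m = Some G ->
       typing (Ps m) ([:: (p, P)] ++ [:: (q, Q)] ++ N) G /\
       (gprt G `|` Ps m) `\` [set p; q] = sprt N) ->
    bdom b `<=` bdom c ->
    bounded (Comm p q g) ->
    typing (\bigcup_(m in bdom b) Ps m) M (Comm p q g)
| typing_weak M M1 M2 P1 P2 G :
    scongr M (M1 ++ M2) ->
    typing P1 M1 G ->
    P2 = sprt M2 -> P2 !=set0 ->
    typing (P1 `|` P2) M G.

Definition excluded_lock_free (Part Msg : Type) (Ps : set Part)
    (M : session Part Msg) : Prop :=
  forall s M' p, steps M s M' -> (sprt M' `\` Ps) p ->
    exists s' L M'', lprt L p /\ steps M' (s' ++ [:: L]) M''.

(* Main.v *)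
(* Along a typing derivation, the pair r, s at the root of the global type is
   always ready, and neither can interact with anybody else.  Hence in any trace
   from M either the first action of r or s is their mutual communication, which
   can be moved to the front, or r and s stay ready to the end and their
   communication commutes with the whole trace.  Both ways one descends to a
   branch of the global type, with a shorter trace or, if p is neither r nor s,
   with a smaller bound on the depth of p; no typing of the reduct M' of M is
   needed.  Sessions are handled through their lookup functions, which
   characterise structural congruence of well-formed sessions. *)
From Stdlib Require List.
Require Import Defs.
From mathcomp Require Import all_boot.
From mathcomp Require Import boolp classical_sets cardinality.

Set Implicit Arguments.
Unset Strict Implicit.
Unset Printing Implicit Defensive.

Local Open Scope classical_set_scope.

(** * Sessions as functions from participants to processes *)

Section Lookup.
Variables Part Msg : Type.
Implicit Types (M N : session Part Msg) (p q : Part) (P Q : proc Part Msg).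

(** The default [Zero] identifies an absent participant with a null one, as neutrality of [p[[0]]]
    requires. *)
Fixpoint lookup M p : proc Part Msg :=
  if M is (q, P) :: M' then if `[< p = q >] then P else lookup M' p
  else Zero.

Definition update (f : Part -> proc Part Msg) p P : Part -> proc Part Msg :=
  fun x => if `[< x = p >] then P else f x.

Definition remove p M : session Part Msg := [seq x <- M | `[< x.1 <> p >]].

Definition keys M : seq Part := [seq x.1 | x <- M].

Lemma updateE f p P : update f p P p = P.
Proof. by rewrite /update; case: asboolP. Qed.

Lemma update_neq f p P q : q <> p -> update f p P q = f q.
Proof. by rewrite /update; case: asboolP. Qed.

Lemma lookup_cons p P M : lookup ((p, P) :: M) = update (lookup M) p P.
Proof. by apply/funext => x. Qed.

Lemma lookup_notin M p : ~ List.In p (keys M) -> lookup M p = Zero.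
Proof.
elim: M => [//|[q P] M IH] /= npM.
case: asboolP => [pq|npq]; first by case: npM; left.
by apply: IH => ?; apply: npM; right.
Qed.

Lemma in_keys p P M : List.In (p, P) M -> List.In p (keys M).
Proof. by elim: M => [//|x M IH] /= [->|/IH]; [left|right]. Qed.

Lemma lookup_in M p P : List.NoDup (keys M) -> P <> Zero ->
  (lookup M p = P <-> List.In (p, P) M).
Proof.
move=> + P0; elim: M => [_|[q Q] M IH] /=; first by split=> // /esym.
move=> /(@List.NoDup_cons_iff Part) [qM uM]; case: asboolP => [pq|pq].
  split=> [->|[|/in_keys]]; [by left; rewrite pq|congruence|].
  by rewrite pq => /qM.
by rewrite IH//; split=> [|[|//]]; [right|congruence].
Qed.

Lemma lookup_remove p M : lookup (remove p M) = update (lookup M) p Zero.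
Proof.
apply/funext => x; elim: M => [|[q Q] M IH] /=.
  by rewrite /update; case: asboolP.
case: asboolP => /= qp; rewrite /update /= IH /update.
  by case: asboolP => [->|//]; case: asboolP => // pq; case: qp.
case: asboolP => // xp; case: asboolP => // xq.
by case: qp => qp; case: xp; rewrite xq.
Qed.

Lemma remove_id p M : ~ List.In p (keys M) -> remove p M = M.
Proof.
elim: M => [//|[q Q] M IH] /= pM; case: asboolP => [_|]/=.
  by rewrite IH// => ?; apply: pM; right.
by move=> qp; case: pM; left; apply: contrapT.
Qed.

Lemma in_remove p M x : List.In x (remove p M) -> List.In x M /\ x.1 <> p.
Proof.
elim: M => [//|y M IH] /=; case: asboolP => yp /=; last by move=> /IH[]; auto.
by case=> [<-|/IH[]]; auto.
Qed.

Lemma keysP M p : List.In p (keys M) -> exists P, List.In (p, P) M.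
Proof.
elim: M => [//|[q P] M IH] /= [<-|/IH[Q]]; first by exists P; left.
by exists Q; right.
Qed.

Lemma nodup_remove p M : List.NoDup (keys M) -> List.NoDup (keys (remove p M)).
Proof.
elim: M => [//|[q Q] M IH] /= /(@List.NoDup_cons_iff Part)[qM /IH uM].
case: asboolP => //= qp; constructor => //.
by move=> /keysP[P] /in_remove [/in_keys].
Qed.

Lemma notin_remove p M : ~ List.In p (keys (remove p M)).
Proof. by move=> /keysP[P] /in_remove[]. Qed.

(** * Structural congruence through lookup *)

Lemma congr_cons x M N : congr_raw M N -> congr_raw (x :: M) (x :: N).
Proof. exact: (congr_par (congr_refl [:: x])). Qed.

(** If [p] does not occur in [M], the extracted component is null and comes from neutrality, used
    backwards at the empty session. *)
Lemma congr_extract p M : List.NoDup (keys M) ->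
  congr_raw M ((p, lookup M p) :: remove p M).
Proof.
elim: M => [_|[q Q] M IH] /=; first exact/congr_sym/(congr_zero p [::]).
move=> /(@List.NoDup_cons_iff Part) [qM uM]; case: asboolP => [->|pq].
  by case: asboolP => // _; rewrite remove_id//; exact: congr_refl.
case: asboolP => [_|/contrapT qp]; last by case: pq.
apply: (congr_trans (congr_cons (q, Q) (IH uM))).
apply: (congr_par (congr_comm [:: (q, Q)] [:: (p, lookup M p)])).
exact: congr_refl.
Qed.

(** Induction on [M]: the head participant is extracted from [N], whether or not [N] mentions it.
    Once [M] is exhausted, all that is left of [N] is null and is erased. *)
Lemma congr_lookup M N : List.NoDup (keys M) -> List.NoDup (keys N) ->
  lookup M =1 lookup N -> congr_raw M N.
Proof.
elim: M N => [|[p P] M IH] N /=.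
  move=> _; elim: N => [|[q Q] N IH] /=; first by move=> *; exact: congr_refl.
  move=> /(@List.NoDup_cons_iff Part) [qN uN] eqN.
  have := eqN q; case: asboolP => // _ <-.
  apply: (congr_trans (IH uN _)); last exact/congr_sym/congr_zero.
  move=> x; have := eqN x; case: asboolP => // -> _.
  by rewrite lookup_notin.
move=> /(@List.NoDup_cons_iff Part) [pM uM] uN eqMN.
apply: congr_trans (congr_sym (congr_extract p uN)).
have <- : P = lookup N p by rewrite -eqMN; case: asboolP.
apply/congr_cons/IH => //; first exact: nodup_remove.
move=> x; rewrite lookup_remove /update -eqMN.
by case: asboolP => // ->; rewrite lookup_notin.
Qed.

(** Each law preserves the non-null components. Membership is used instead of [lookup] because the
    intermediate terms of a chain of congruences may repeat a name. *)
Lemma congr_in M N p P : congr_raw M N -> P <> Zero ->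
  List.In (p, P) M <-> List.In (p, P) N.
Proof.
move=> + P0; elim=> {M N} //=.
- by move=> M N _ [].
- by move=> M N K _ [? ?] _ [? ?]; split; auto.
- by move=> M M' N N' _ HM _ HN; rewrite !List.in_app_iff; tauto.
- by move=> M N; rewrite !List.in_app_iff; tauto.
- by move=> q M; split=> [[[]//|//]|]; [move=> _ /esym|right].
Qed.

Lemma scongrP M N :
  scongr M N <-> [/\ wf_session M, wf_session N & lookup M = lookup N].
Proof.
split=> [[wM wN MN]|[wM wN MN]]; split=> //; last first.
  by apply: congr_lookup; [case: wM|case: wN|rewrite MN].
apply/funext => p; have [uM uN] := (wM.1, wN.1).
case: (pselect (lookup M p = Zero)) => [M0|M0].
  rewrite M0; apply: contrapT => /nesym N0; apply: (N0).
  have /(lookup_in p uN N0) := erefl (lookup N p).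
  by move=> /(congr_in p MN N0) /(lookup_in p uM N0); rewrite M0.
have /(lookup_in p uM M0) := erefl (lookup M p).
by move=> /(congr_in p MN M0) /(lookup_in p uN M0).
Qed.

(** * Well-formedness, concatenation and active participants *)

Lemma wf_zero : wf_proc (Zero : proc Part Msg).
Proof.
split; last by move=> Q QZ; inversion QZ.
exists [:: Zero] => Q QZ; inversion QZ; subst; exists Zero; first by left.
exact: bisim_zero.
Qed.

Lemma wf_lookup M p : wf_session M -> wf_proc (lookup M p).
Proof.
move=> [uM wM]; case: (pselect (lookup M p = Zero)) => [->|P0].
  exact: wf_zero.
exact/(wM p)/lookup_in.
Qed.

Lemma wf_subproc P Q : (forall R, subproc R P -> subproc R Q) ->
  wf_proc Q -> wf_proc P.
Proof.
move=> sub [[s rQ] bQ]; split; last by move=> R /sub/bQ.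
by exists s => R /sub/rQ.
Qed.

Lemma wf_out q b m P : b m = Some P -> wf_proc (Out q b) -> wf_proc P.
Proof. by move=> bm; apply: wf_subproc => R; apply: subproc_out bm. Qed.

Lemma wf_inp q b m P : b m = Some P -> wf_proc (Inp q b) -> wf_proc P.
Proof. by move=> bm; apply: wf_subproc => R; apply: subproc_inp bm. Qed.

Lemma wf_remove p M : wf_session M -> wf_session (remove p M).
Proof.
move=> [uM wM]; split; first exact: nodup_remove.
by move=> q Q /in_remove[/wM].
Qed.

Lemma wf_cons p P M : wf_session M -> ~ List.In p (keys M) -> wf_proc P ->
  wf_session ((p, P) :: M).
Proof.
move=> [uM wM] pM wP; split; first exact: List.NoDup_cons.
by move=> q Q /= [[_ <-]|/wM].
Qed.

Lemma wf_catl M N : wf_session (M ++ N) -> wf_session M.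
Proof.
move=> [+ wMN]; rewrite map_cat => uMN; split.
  exact: List.NoDup_app_remove_r uMN.
by move=> p P ?; apply: (wMN p P); apply/List.in_app_iff; left.
Qed.

Lemma wf_catr M N : wf_session (M ++ N) -> wf_session N.
Proof.
move=> [+ wMN]; rewrite map_cat => uMN; split.
  exact: List.NoDup_app_remove_l uMN.
by move=> p P ?; apply: (wMN p P); apply/List.in_app_iff; right.
Qed.

Lemma lookup_catl M N p : lookup M p <> Zero -> lookup (M ++ N) p = lookup M p.
Proof. by elim: M => [//|[q Q] M IH] /=; case: asboolP. Qed.

Lemma lookup_catr M N p : wf_session (M ++ N) -> lookup M p = Zero ->
  lookup (M ++ N) p = lookup N p.
Proof.
case=> + _; elim: M => [//|[q Q] M IH] /=.
move=> /(@List.NoDup_cons_iff Part)[qMN uMN].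
case: asboolP => [-> ->|_]; last exact: IH.
rewrite lookup_notin// => pN; apply: qMN; rewrite map_cat.
by apply/List.in_app_iff; right; congr List.In: pN.
Qed.

Lemma sprtE M : wf_session M -> sprt M = [set p | lookup M p <> Zero].
Proof.
move=> wM; apply/seteqP; split=> p /=.
  by move=> [P [P0 [N /scongrP[_ _ ->]]]] /=; case: asboolP.
move=> P0; exists (lookup M p); split=> //; exists (remove p M).
apply/scongrP; split=> //.
  by apply: wf_cons; [exact: wf_remove|exact: notin_remove|exact: wf_lookup].
rewrite lookup_cons lookup_remove; apply/funext => x; rewrite /update.
by case: asboolP => // ->.
Qed.

End Lookup.

(** * Transitions on lookup functions *)

Section Configurations.
Variables Part Msg : Type.
Implicit Types (M N : session Part Msg) (f : Part -> proc Part Msg).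
Implicit Types (G : gtype Part Msg) (p q r s : Part) (L : label Part Msg).

Definition update2 f p P q Q := update (update f p P) q Q.

Lemma update2_neq f p P q Q x : x <> p -> x <> q -> update2 f p P q Q x = f x.
Proof. by move=> xp xq; rewrite /update2 !update_neq. Qed.

Lemma update2C f p P q Q r R s S : p <> r -> p <> s -> q <> r -> q <> s ->
  update2 (update2 f p P q Q) r R s S = update2 (update2 f r R s S) p P q Q.
Proof.
move=> pr ps qr qs; apply/funext => x; rewrite /update2 /update.
by repeat (case: asboolP => ?); congruence.
Qed.

(** No congruence rule appears, since congruent sessions have the same lookup function. *)
Inductive cstep f : label Part Msg -> (Part -> proc Part Msg) -> Prop :=
| Cstep p q b c m P Q : f p = Out q b -> f q = Inp p c ->
    bdom b `<=` bdom c -> b m = Some P -> c m = Some Q ->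
    cstep f (Label p m q) (update2 f p P q Q).

Inductive csteps f : seq (label Part Msg) -> (Part -> proc Part Msg) -> Prop :=
| csteps_nil : csteps f [::] f
| csteps_cons L f' t f'' :
    cstep f L f' -> csteps f' t f'' -> csteps f (L :: t) f''.

Lemma lookup_comm p P q Q M : p <> q ->
  lookup ([:: (p, P)] ++ [:: (q, Q)] ++ M) = update2 (lookup M) p P q Q.
Proof.
move=> pq; rewrite !lookup_cons; apply/funext => x; rewrite /update2 /update.
by repeat (case: asboolP => ?); congruence.
Qed.

Lemma update2_id f p P q Q P' Q' : p <> q ->
  update2 (update2 f p P q Q) p P' q Q' = update2 f p P' q Q'.
Proof.
move=> pq; apply/funext => x; rewrite /update2 /update.
by repeat (case: asboolP => ?); congruence.
Qed.

(** A session realising [update2] on lookups; the old entries are removed to keep names distinct. *)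
Definition replace2 M p P q Q : session Part Msg :=
  [:: (p, P)] ++ [:: (q, Q)] ++ remove q (remove p M).

Lemma lookup_replace2 M p P q Q : p <> q ->
  lookup (replace2 M p P q Q) = update2 (lookup M) p P q Q.
Proof.
move=> pq; rewrite lookup_comm// !lookup_remove.
exact: update2_id.
Qed.

Lemma wf_replace2 M p P q Q : p <> q -> wf_session M -> wf_proc P -> wf_proc Q ->
  wf_session (replace2 M p P q Q).
Proof.
move=> pq wM wP wQ; apply: wf_cons => //; first apply: wf_cons => //.
- exact/wf_remove/wf_remove.
- exact: notin_remove.
- case=> [qp|/(@keysP _ _ (remove q (remove p M)))[R pM]].
    exact/pq/esym.
  have [pM' _] := in_remove pM; exact: notin_remove (in_keys pM').
Qed.

Lemma wf_comm_neq p P q Q M :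
  wf_session ([:: (p, P)] ++ [:: (q, Q)] ++ M) -> p <> q.
Proof.
move=> [+ _] pq; rewrite /= => /(@List.NoDup_cons_iff Part)[+ _].
by apply; left.
Qed.

Lemma wf_comm p P q Q P' Q' M :
  wf_session ([:: (p, P)] ++ [:: (q, Q)] ++ M) -> wf_proc P' -> wf_proc Q' ->
  wf_session ([:: (p, P')] ++ [:: (q, Q')] ++ M).
Proof.
move=> [uM wM] wP' wQ'; split=> // x X /= [[_ <-]//|[[_ <-]//|xM]].
by apply: (wM x); right; right.
Qed.

Lemma cstep_in_step M L f : wf_session M -> cstep (lookup M) L f ->
  exists2 N, lookup N = f & step M L N.
Proof.
move=> wM st; case: st => p q b c m P Q Mp Mq bc bP cQ.
have pq : p <> q by move=> pq; move: Mp; rewrite pq Mq.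
have wb : wf_proc (Out q b) by rewrite -Mp; exact: wf_lookup.
have wc : wf_proc (Inp p c) by rewrite -Mq; exact: wf_lookup.
have wN : wf_session (replace2 M p (Out q b) q (Inp p c)) by exact: wf_replace2.
have wN' : wf_session (replace2 M p P q Q).
  by apply: (wf_comm wN); [apply: wf_out wb|apply: wf_inp wc]; eassumption.
exists (replace2 M p P q Q); first exact: lookup_replace2.
(* Congruence first brings the two partners to the front, where the communication rule applies. *)
apply: (step_congr (N := replace2 M p (Out q b) q (Inp p c)));
  [|exact: step_comm wN bc bP cQ|exact/scongrP].
apply/scongrP; split=> //; rewrite lookup_replace2// -Mp -Mq.
apply/funext => x; rewrite /update2 /update.
by repeat (case: asboolP => ?); congruence.
Qed.

Lemma step_cstep M L N : step M L N ->
  [/\ wf_session M, wf_session N & cstep (lookup M) L (lookup N)].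
Proof.
elim=> {M L N} [p q b c M m P Q wM bc bP cQ|M N L N' M' + _ [wN wN' st] +].
  have pq := wf_comm_neq wM; have [_ wM'] := wM.
  have wb : wf_proc (Out q b) by apply: (wM' p); left.
  have wc : wf_proc (Inp p c) by apply: (wM' q); right; left.
  split=> //.
    by apply: wf_comm wM _ _; [apply: wf_out wb|apply: wf_inp wc]; eassumption.
  rewrite !lookup_comm// -(update2_id _ (Out q b) (Inp p c) P Q pq).
  apply: (Cstep (b := b) (c := c)) => //; last by rewrite /update2 updateE.
  by rewrite /update2 update_neq// updateE.
by move=> /scongrP[wM _ ->] /scongrP[_ wM' <-].
Qed.

Lemma steps_csteps M t N : wf_session M -> steps M t N ->
  wf_session N /\ csteps (lookup M) t (lookup N).
Proof.
move=> + st; elim: st => {M t N} [M M' /scongrP[_ wM' ->] _|].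
  by split=> //; exact: csteps_nil.
move=> M L N t M' /step_cstep[_ wN st] _ IH _.
by have [wM' ?] := IH wN; split=> //; exact: csteps_cons st _.
Qed.

Lemma csteps_steps M t f : wf_session M -> csteps (lookup M) t f ->
  exists N, steps M t N.
Proof.
move=> + st; move Mf: (lookup M) st => f0 st.
elim: st M Mf => {f0 t f} [f M _ wM|f0 L f t f' st _ IH M Mf wM].
  by exists M; apply/steps_nil/scongrP.
move: st; rewrite -Mf => /(cstep_in_step wM)[N Nf st].
have [_ wN _] := step_cstep st.
by have [N' ?] := IH N Nf wN; exists N'; exact: steps_cons st _.
Qed.

(** A null process takes part in no transition. Contrapositively, a participant active at the end of
    a trace was active at its start. *)
Lemma csteps_lookup0 f t f' p : csteps f t f' -> f p = Zero -> f' p = Zero.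
Proof.
elim=> {f t f'} // f L f' t f'' st _ IH fp; apply: IH.
case: st => r s b c m P Q fr fs _ _ _.
by rewrite update2_neq// => E; move: fp; rewrite E ?fr ?fs.
Qed.

(* The partners of a ready pair r, s are determined by their processes, so their
   next action is their mutual communication, which commutes with all actions
   of the others. *)
Lemma csteps_ready f t f' r s b c :
  f r = Out s b -> f s = Inp r c -> csteps f t f' ->
  ([/\ f' r = Out s b, f' s = Inp r c &
      forall P Q, csteps (update2 f r P s Q) t (update2 f' r P s Q)]) \/
  (exists m P Q t', [/\ b m = Some P, c m = Some Q,
      csteps (update2 f r P s Q) t' f' & size t = (size t').+1]).
Proof.
move=> + + st; elim: st => {f t f'} [f fr fs|f L f' t f'' st st' IH fr fs].
  by left; split=> // P Q; exact: csteps_nil.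
case: st st' IH => p q b' c' m P Q fp fq bc bP cQ st' IH.
have [Ep|rp] := pselect (p = r).
  subst p; move: fp; rewrite fr => -[Eq Eb]; subst q b'.
  move: fq; rewrite fs => -[Ec]; subst c'.
  by right; exists m, P, Q, t.
have sp : p <> s by move=> E; move: fp; rewrite E fs.
have rq : q <> r by move=> E; move: fq; rewrite E fr.
have sq : q <> s by move=> E; move: fq; rewrite E fs => -[/esym].
have step2 P' Q' :
    cstep (update2 f r P' s Q') (Label p m q)
          (update2 (update2 f p P q Q) r P' s Q').
  rewrite update2C//.
  by apply: (Cstep (b := b') (c := c')) => //; rewrite update2_neq.
have [||[f''r f''s st2]|] := IH; rewrite ?update2_neq//; try exact: nesym.
  left; split=> // P' Q'; exact: csteps_cons (step2 _ _) (st2 _ _).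
move=> [m' [P' [Q' [t' [bP' cQ' st2 szt]]]]].
right; exists m', P', Q', (Label p m q :: t'); split=> //=.
  exact: csteps_cons (step2 _ _) st2.
by rewrite szt.
Qed.

(** * Inversion of typing derivations *)

Lemma scongr_trans M N K : scongr M N -> scongr N K -> scongr M K.
Proof. by move=> [wM _ MN] [_ wK NK]; split=> //; exact: congr_trans NK. Qed.

(** Every rule starts with a congruence, so composing at the root suffices and no coinduction is
    involved. *)
Lemma typing_scongr Ps M N G : scongr N M -> typing Ps M G -> typing Ps N G.
Proof.
move=> + tM; case: tM => {Ps M G}.
- by move=> M p MK NM; exact: typing_end (scongr_trans NM MK).
- move=> M p q b c K g Ps MK gb tK bc bdd NM.
  exact: typing_comm (scongr_trans NM MK) gb tK bc bdd.
- move=> M M1 M2 P1 P2 G MK tM E ne NM.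
  exact: typing_weak (scongr_trans NM MK) tM E ne.
Qed.

Lemma typing_wf Ps M G : typing Ps M G -> wf_session M.
Proof. by case=> {Ps G} *; match goal with H : scongr _ _ |- _ => case: H end. Qed.

(** The weakening rule demands an active participant in [N]; when there is none, [M ++ N] is
    congruent to [M]. *)
Lemma typing_weakening Ps M N G : wf_session (M ++ N) -> typing Ps M G ->
  exists2 Qs, Qs `<=` Ps `|` sprt N & typing Qs (M ++ N) G.
Proof.
move=> wMN tM; have [wM wN] := (wf_catl wMN, wf_catr wMN).
have [nN0|N0] := pselect (sprt N !=set0).
  exists (Ps `|` sprt N) => //; apply: typing_weak tM _ nN0 => //.
  exact/scongrP.
exists Ps; first exact: subsetUl.
apply: typing_scongr tM; apply/scongrP; split=> //; apply/funext => p.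
have [M0|M0] := pselect (lookup M p = Zero); last exact: lookup_catl.
rewrite lookup_catr// M0; apply: contrapT => Np; apply: N0.
by exists p; rewrite sprtE.
Qed.

(** Measure for chains of weakenings: invariant under congruence, and smaller after each one. *)
Definition nonzero_size M : nat := count (fun x => `[< x.2 <> Zero >]) M.

Lemma nonzero_size_congr M N : congr_raw M N -> nonzero_size M = nonzero_size N.
Proof.
rewrite /nonzero_size; elim=> {M N} //.
- by move=> M N K _ -> _ ->.
- by move=> M M' N N' _ IHM _ IHN; rewrite !count_cat IHM IHN.
- by move=> M N; rewrite !count_cat addnC.
- by move=> p M /=; case: asboolP.
Qed.

Lemma nonzero_size_gt0 M p : lookup M p <> Zero -> (0 < nonzero_size M)%N.
Proof.
elim: M => [//|[q Q] M IH] /=; case: asboolP => [_|_ /IH].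
  by case: asboolP.
by rewrite /nonzero_size /= addn_gt0 orbC => ->.
Qed.

Lemma gprt_comm p q (g : branching Msg (gtype Part Msg)) m G :
  g m = Some G -> gprt G `<=` gprt (Comm p q g).
Proof.
move=> gm x [t Gt [n [L [tn Lx]]]].
exists (Tcons (Label p m q) t); first exact: paths_comm gm Gt.
by exists n.+1, L.
Qed.

(** What remains of a derivation once the weakenings at its root are absorbed: an [End] with all
    active participants ignored, or a communication whose premises concern the whole of [M]. Only
    non-membership in the ignored set is exploited later, so an inclusion is enough for the
    continuations. *)
Definition typed_head Ps M G : Prop :=
  (forall p, lookup M p <> Zero -> Ps p) \/
  exists r s b c g,
    [/\ G = Comm r s g, lookup M r = Out s b, lookup M s = Inp r c,
        bounded G & bdom b `<=` bdom g] /\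
    [/\ bdom b `<=` bdom c,
        forall p, lookup M p <> Zero -> [\/ Ps p, p = r, p = s | gprt G p] &
        forall m P Q H, b m = Some P -> c m = Some Q -> g m = Some H ->
          exists2 Qs, Qs `<=` Ps & typing Qs (replace2 M r P s Q) H].

(* Consecutive uses of the weakening rule are finitely many, since each one
   drops a participant; the participants they ignore are reinstated, by the
   same rule, after the first communication. *)
Lemma typing_head Ps M G : typing Ps M G -> typed_head Ps M G.
Proof.
move: {2}(nonzero_size M).+1 (ltnSn (nonzero_size M)) => n.
elim: n Ps M G => [//|n IH] Ps M G nM tM; have wM := typing_wf tM.
case: tM nM wM => {Ps M G} [M p|M r s b c N g Qs|].
- by move=> /scongrP[_ _ Mp] _ _; left => q; rewrite Mp /=; case: asboolP.
- move=> /scongrP[_ wN MN] gb tN bc bdd _ wM; right.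
  have rs := wf_comm_neq wN.
  have [Mr Ms] : lookup M r = Out s b /\ lookup M s = Inp r c.
    rewrite MN lookup_comm// /update2 updateE; split=> //.
    by rewrite update_neq// updateE.
  exists r, s, b, c, g; split; first by split=> //; rewrite gb.
  split=> // [p p0|m P Q H bP cQ gH].
    have [pr|pr] := pselect (p = r); first by constructor 2.
    have [ps|ps] := pselect (p = s); first by constructor 3.
    (* The output branching is nonempty, so some premise exists, and its equation on participants
       locates [p]. *)
    have [/= _] : wf_proc (Out s b) by rewrite -Mr; exact: wf_lookup.
    move=> /(_ _ (subproc_refl _))[_ [m [P bP]]].
    have [Q cQ] : bdom c m by apply: bc; exists P.
    have [H gH] : bdom g m by rewrite gb; exists P.
    have [_ /seteqP[_ /(_ p)]] := tN m P Q H bP cQ gH.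
    rewrite sprtE; last exact: (@wf_catr _ _ [:: (r, Out s b); (s, Inp r c)]).
    move: p0; rewrite MN lookup_comm// update2_neq// => p0 /(_ p0)[[Hp|Qp] _].
      by constructor 4; apply: gprt_comm gH _ Hp.
    by constructor 1; exists m => //; exists P.
  exists (Qs m); first by move=> x Qx; exists m => //; exists P.
  have [tH _] := tN m P Q H bP cQ gH; apply: typing_scongr tH.
  have wN' := typing_wf (tN m P Q H bP cQ gH).1.
  apply/scongrP; split=> //.
    apply: wf_replace2 => //; case: wN' => _ wN'.
      by apply: (wN' r); left.
    by apply: (wN' s); right; left.
  by rewrite lookup_replace2// MN !lookup_comm// update2_id.
move=> M M1 M2 P1 P2 G MM tM1 -> {P2} ne nM wM.
have /scongrP[_ wMM eqM] := MM; have [wM1 wM2] := (wf_catl wMM, wf_catr wMM).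
have [|hd|[r [s [b [c [g [[GE Mr Ms bdd bg] [bc prt ty]]]]]]]] := IH P1 M1 G _ tM1.
- move: ne; rewrite sprtE// => -[p /nonzero_size_gt0 M2p].
  have [_ _ /nonzero_size_congr EM] := MM.
  move: nM; rewrite EM /nonzero_size count_cat ltnS; apply: leq_trans.
  by rewrite -[X in (X < _)%N]addn0 ltn_add2l.
- left=> p; rewrite eqM => p0.
  have [M10|/hd] := pselect (lookup M1 p = Zero); last by left.
  by right; rewrite sprtE//=; rewrite -(lookup_catr wMM).
right; exists r, s, b, c, g.
have Mr' : lookup M r = Out s b by rewrite eqM lookup_catl Mr.
have Ms' : lookup M s = Inp r c by rewrite eqM lookup_catl Ms.
have rs : r <> s by move=> E; move: Mr; rewrite E Ms.
split; first by [].
split=> // [p|m P Q H bP cQ gH].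
  rewrite eqM => p0.
  have [M10|/prt] := pselect (lookup M1 p = Zero).
    by constructor 1; right; rewrite sprtE//=; rewrite -(lookup_catr wMM).
  by case=> ?; [constructor 1; left|constructor 2|constructor 3|constructor 4].
have [Qs Qs1 tH] := ty m P Q H bP cQ gH.
have wb : wf_proc (Out s b) by rewrite -Mr; exact: wf_lookup.
have wc : wf_proc (Inp r c) by rewrite -Ms; exact: wf_lookup.
have wP := wf_out bP wb; have wQ := wf_inp cQ wc.
(* As [r] and [s] occur in [M1], the removals do not change [M2]; they make the concatenation
   literally [replace2] of [M1 ++ M2]. *)
set N2 := remove s (remove r M2).
have E : replace2 M1 r P s Q ++ N2 = replace2 (M1 ++ M2) r P s Q.
  by rewrite /replace2 /remove !filter_cat.
have wE : wf_session (replace2 M1 r P s Q ++ N2).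
  by rewrite E; exact: wf_replace2.
have [Rs RsQ tE] := typing_weakening wE tH.
exists Rs.
  move=> p /RsQ [/Qs1|]; first by left.
  rewrite !sprtE//; last by do 2 apply: wf_remove.
  rewrite /= !lookup_remove /update; do 2 case: asboolP => // _.
  by right.
apply: typing_scongr tE; rewrite E; apply/scongrP; split.
- exact: wf_replace2.
- by rewrite -E.
- by rewrite !lookup_replace2// eqM.
Qed.

(** * Depth bounds and the two nested inductions *)

Lemma tdepthP (t : trace Part Msg) p d : tdepth t p = Some d ->
  exists2 L, Defs.tnth t d = Some L & lprt L p.
Proof.
rewrite /tdepth /enat_inf; case: pselect => // ex [<-].
by case: ex_minnP => n /asboolP.
Qed.

(** A path missing [p] would have infinite depth, so a finite supremum forces [p] to occur on every
    path, within a common bound. *)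
Lemma bounded_depth G p : bounded G -> gprt G p ->
  exists d, forall t, paths G t ->
    exists2 n, (n < d)%N & exists2 L, Defs.tnth t n = Some L & lprt L p.
Proof.
move=> bG Gp; have := bG G p (subgtype_refl G) Gp.
rewrite /gdepth asboolT// /enat_sup /enat_inf; case: pselect => // -[d].
(* The successor makes the bound strict. *)
move=> /asboolP dP _; exists d.+1 => t Gt.
have [k /tdepthP tk kd] : exists2 k, tdepth t p = Some k & (k <= d)%N.
  by apply: dP; exists t.
by exists k.
Qed.

Definition unlocked f p : Prop :=
  exists t L f', lprt L p /\ csteps f (t ++ [:: L]) f'.

Lemma unlocked_cstep f L f' p : cstep f L f' -> unlocked f' p -> unlocked f p.
Proof.
move=> st [t [L' [f'' [Lp sts]]]].
by exists (L :: t), L', f''; split=> //; exact: csteps_cons st sts.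
Qed.

(** Inner induction, on the depth bound [d]; the first hypothesis is the outer one, for shorter
    traces. *)
Lemma typing_unlocked_depth n d Ps M G t f p :
  (forall Ps' M' G' t' f', (size t' < n)%N -> typing Ps' M' G' ->
     csteps (lookup M') t' f' -> f' p <> Zero -> ~ Ps' p -> unlocked f' p) ->
  (forall u, paths G u ->
     exists2 k, (k < d)%N & exists2 L, Defs.tnth u k = Some L & lprt L p) ->
  (size t <= n)%N -> typing Ps M G -> csteps (lookup M) t f ->
  f p <> Zero -> ~ Ps p -> unlocked f p.
Proof.
move=> IHn; elim/ltn_ind: d => d IHd in Ps M G t f *.
move=> dG szt tM st fp nPs; have wM := typing_wf tM.
have Mp : lookup M p <> Zero by move=> /(csteps_lookup0 st).
case: (typing_head tM) => [/(_ _ Mp)//|].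
move=> [r [s [b [c [g [[GE Mr Ms bdd bg] [bc prt ty]]]]]]].
have rs : r <> s by move=> E; move: Mr; rewrite E Ms.
case: (csteps_ready Mr Ms st) => [[fr fs stP]|]; last first.
  (* The pair has communicated along [t]: with that communication moved to the front, the reduct
     reaches the same [f] by a shorter trace. *)
  move=> [m [P [Q [t' [bP cQ st' szE]]]]].
  have [H gH] : bdom g m by apply: bg; exists P.
  have [Qs QsP tH] := ty m P Q H bP cQ gH.
  apply: (IHn Qs _ H t' f _ tH) => //; first by rewrite -ltnS -szE ltnS.
    by rewrite lookup_replace2.
  by move=> /QsP.
(* The pair is still ready in [f], and any message of its nonempty branching will do. *)
have [/= _] : wf_proc (Out s b) by rewrite -Mr; exact: wf_lookup.
move=> /(_ _ (subproc_refl _))[_ [m [P bP]]].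
have [Q cQ] : bdom c m by apply: bc; exists P.
have [H gH] : bdom g m by apply: bg; exists P.
have stm := Cstep fr fs bc bP cQ.
have now : lprt (Label r m s) p -> unlocked f p.
  move=> Lp; exists [::], (Label r m s), (update2 f r P s Q); split=> //.
  by apply: csteps_cons stm _; exact: csteps_nil.
have [pr|pr] := pselect (p = r); first by apply: now; left.
have [ps|ps] := pselect (p = s); first by apply: now; right.
(* Here [p] must occur in [G]; the path [u] only serves to show that [d] is positive. *)
case: (prt p Mp) => // - [u Gu _].
have d0 : (0 < d)%N by have [k /(leq_ltn_trans (leq0n k))] := dG u Gu.
have [Qs QsP tH] := ty m P Q H bP cQ gH.
apply: unlocked_cstep stm _.
apply: (IHd d.-1 _ Qs _ H t _ _ szt tH) => //.
- by rewrite prednK.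
(* A path of the branch extends to one of [G] by a label not involving [p], so positions of [p] drop
   by one. *)
- move=> v Hv; have Gv : paths G (Tcons (Label r m s) v).
    by rewrite GE; exact: paths_comm gH Hv.
  have [[|k] kd [L tL Lp]] := dG _ Gv; first by case: tL Lp => <- [].
  by exists k; [rewrite -ltnS prednK|exists L].
- by rewrite lookup_replace2.
- by rewrite update2_neq.
- by move=> /QsP.
Qed.

(** For the two partners at the root the bound is 1; any other participant that is active and not
    ignored occurs in [G], which is bounded. *)
Lemma typing_depth Ps M G p : typing Ps M G -> lookup M p <> Zero -> ~ Ps p ->
  exists d, forall u, paths G u ->
    exists2 k, (k < d)%N & exists2 L, Defs.tnth u k = Some L & lprt L p.
Proof.
move=> /typing_head [hd /hd //|].
move=> [r [s [b [c [g [[-> _ _ bdd _] [_ prt _]]]]]]] Mp nPs.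
have now : p = r \/ p = s -> exists d, forall u, paths (Comm r s g) u ->
    exists2 k, (k < d)%N & exists2 L, Defs.tnth u k = Some L & lprt L p.
  move=> Lp; exists 1 => u Gu; exists 0 => //.
  by inversion Gu; subst; eexists; first by [].
case: (prt p Mp) => [//|?|?|/(bounded_depth bdd)//]; apply: now; tauto.
Qed.

(** Outer induction, on the length of the trace. The depth bound is taken afresh each time: if [p]
    is one of the partners just removed, the old bound says nothing about the branch. *)
Lemma typing_unlocked Ps M G t f p : typing Ps M G -> csteps (lookup M) t f ->
  f p <> Zero -> ~ Ps p -> unlocked f p.
Proof.
move: {2}(size t) (leqnn (size t)) => n.
elim/ltn_ind: n => n IHn in Ps M G t f *; move=> szt tM st fp nPs.
have Mp : lookup M p <> Zero by move=> /(csteps_lookup0 st).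
have [d dG] := typing_depth tM Mp nPs.
apply: (typing_unlocked_depth _ dG szt tM st fp nPs).
by move=> Ps' M' G' t' f' szt'; exact: IHn szt' _ _ _ _ _ (leqnn _).
Qed.

End Configurations.

Theorem theorem3 (Part Msg : Type) (Ps : set Part) (M : session Part Msg)
  (G : gtype Part Msg) (hPs : finite_set Ps) (hM : wf_session M)
  (hG : wf_gtype G) :
  typing Ps M G -> excluded_lock_free Ps M.
Proof.
move=> tM s M' p /(steps_csteps hM)[wM' st] [].
rewrite sprtE// => /= M'p nPs.
have [t [L [f [Lp stf]]]] := typing_unlocked tM st M'p nPs.
by have [N stN] := csteps_steps wM' stf; exists t, L, N.
Qed.
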